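(* Let $(A,\mu)$ be an alternative algebra, with $\mu(x,y)$ written $xy$, and let $\alpha\colon A\to A$ be an algebra morphism. Then $A^+_\alpha=(A,\{,,\}_\alpha,\alpha)$ (with both twisting maps equal to $\alpha$) is a multiplicative Hom-Jordan triple system, where $$\{xyz\}_\alpha=\alpha\left(x*(y*z)+(x*y)*z-y*(x*z)\right)\quad\text{and}\quad x*y=\frac{xy+yx}{2}.$$
   Context: We work over a fixed field $\mathbf{k}$ of characteristic $0$. An alternative algebra $(A,\mu)$ is a $\mathbf{k}$-module with a bilinear multiplication such that the associator $as(x,y,z)=(xy)z-x(yz)$ is anti-symmetric in its three arguments. An algebra morphism $\alpha\colon A\to A$ is a linear map with $\alpha(xy)=\alpha(x)\alpha(y)$. A Hom-Jordan triple system $(J,\{,,\},(\alpha_1,\alpha_2))$ is a $\mathbf{k}$-module $J$ with a trilinear map $\{,,\}\colon J^{\otimes 3}\to J$ and linear maps $\alpha_1,\alpha_2\colon J\to J$ (twisting maps) such that $\{xyz\}=\{zyx\}$ and $$\{\alpha_1(x)\alpha_2(y)\{uvw\}\}-\{\alpha_1(u)\alpha_2(v)\{xyw\}\}=\{\{xyu\}\alpha_1(v)\alpha_2(w)\}-\{\alpha_1(u)\{yxv\}\alpha_2(w)\}$$ for all $u,v,w,x,y,z\in J$. When $\alpha_1=\alpha_2=\alpha$ we write $(J,\{,,\},\alpha)$. It is multiplicative if $\alpha_1=\alpha_2=\alpha$ and $\alpha(\{xyz\})=\{\alpha(x)\alpha(y)\alpha(z)\}$ for all $x,y,z$. *)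

(* Defs.v *)
From HB Require Import structures.
From mathcomp Require Import all_boot all_order all_algebra.

Set Implicit Arguments.
Unset Strict Implicit.
Unset Printing Implicit Defensive.

Import GRing.Theory.
Local Open Scope ring_scope.

(* Algebras here need be neither associative nor unital, so the multiplication
   is a bilinear map on a module rather than a ring structure. *)
Section Algebras.
Variables (k : fieldType) (A : lmodType k).
Implicit Types mu : {bilinear A -> A -> A}.

Definition associator mu (x y z : A) : A := mu (mu x y) z - mu x (mu y z).

Definition alternative_algebra mu : Prop :=
  [/\ forall x y z, associator mu y x z = - associator mu x y z,
      forall x y z, associator mu x z y = - associator mu x y z
    & forall x y z, associator mu z y x = - associator mu x y z].

Definition algebra_morphism mu (alpha : {linear A -> A}) : Prop :=
  {morph alpha : x y / mu x y >-> mu x y}.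

Definition jordan_mul mu (x y : A) : A := 2%:R^-1 *: (mu x y + mu y x).

Definition twisted_triple mu (alpha : A -> A) (x y z : A) : A :=
  let star := jordan_mul mu in
  alpha (star x (star y z) + star (star x y) z - star y (star x z)).

End Algebras.

Section HomJordanTripleSystems.
Variables (k : fieldType) (J : lmodType k).
Implicit Types (T : J -> J -> J -> J) (alpha : J -> J).

Definition trilinear T : Prop :=
  [/\ forall y z, linear (fun x => T x y z),
      forall x z, linear (fun y => T x y z)
    & forall x y, linear (fun z => T x y z)].

Record hom_jordan_triple_system T (alpha1 alpha2 : J -> J) : Prop := {
  hjts_trilinear : trilinear T;
  hjts_linear1 : linear alpha1;
  hjts_linear2 : linear alpha2;
  hjts_sym : forall x y z, T x y z = T z y x;
  hjts_identity : forall x y u v w,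
    T (alpha1 x) (alpha2 y) (T u v w) - T (alpha1 u) (alpha2 v) (T x y w)
    = T (T x y u) (alpha1 v) (alpha2 w) - T (alpha1 u) (T y x v) (alpha2 w)
}.

Definition multiplicative_hjts T alpha : Prop :=
  hom_jordan_triple_system T alpha alpha /\
  (forall x y z, alpha (T x y z) = T (alpha x) (alpha y) (alpha z)).

End HomJordanTripleSystems.

(* Main.v *)
(* Put Q(x,y,z) = (xy)z + (zy)x and T_a z = az + za. In an alternative algebra
   the Jordan triple product is Q/2, and the linearized Moufang identity says
   T_a Q(u,v,w) = Q(T_a u,v,w) - Q(u,T_a v,w) + Q(u,v,T_a w). Since the
   operators Q(x,y,-) and Q(y,x,-) have sum T_{xy+yx} and difference
   [T_x,T_y], twice Q(x,y,-) is T_{xy+yx} + [T_x,T_y], and the Jordan triple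
   identity for Q follows; alpha, being a morphism, only contributes an overall
   factor alpha^2 to both sides. *)
Require Import Defs.
From HB Require Import structures.
From mathcomp Require Import all_boot all_order all_algebra.

Set Implicit Arguments.
Unset Strict Implicit.
Unset Printing Implicit Defensive.

Import GRing.Theory.
Local Open Scope ring_scope.

(** * Reflective proofs of abelian group identities *)

Inductive zmod_expr :=
  ZAtom of nat | ZZero | ZAdd of zmod_expr & zmod_expr | ZOpp of zmod_expr.

Fixpoint zmod_eval (V : zmodType) (env : seq V) e : V :=
  match e with
  | ZAtom i => env`_i
  | ZZero => 0
  | ZAdd e1 e2 => zmod_eval env e1 + zmod_eval env e2
  | ZOpp e1 => - zmod_eval env e1
  end.

(** [s] is the sign being collected: [true] gathers positive occurrences, [false] negative ones. *)
Fixpoint zmod_terms (s : bool) e : seq nat :=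
  match e with
  | ZAtom i => if s then [:: i] else [::]
  | ZZero => [::]
  | ZAdd e1 e2 => zmod_terms s e1 ++ zmod_terms s e2
  | ZOpp e1 => zmod_terms (~~ s) e1
  end.

Lemma zmod_evalE (V : zmodType) (env : seq V) e :
  zmod_eval env e = \sum_(i <- zmod_terms true e) env`_i
                    - \sum_(i <- zmod_terms false e) env`_i.
Proof.
elim: e => [i||e1 IH1 e2 IH2|e IH] /=.
- by rewrite big_seq1 big_nil subr0.
- by rewrite big_nil subr0.
- by rewrite !big_cat /= IH1 IH2 opprD addrACA.
- by rewrite IH opprB.
Qed.

(** Moving negative terms across the equation leaves a plain sum of atoms on each side. *)
Lemma zmod_eval_eq (V : zmodType) (env : seq V) e1 e2 :
  perm_eq (zmod_terms true e1 ++ zmod_terms false e2)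
          (zmod_terms true e2 ++ zmod_terms false e1) ->
  zmod_eval env e1 = zmod_eval env e2.
Proof.
move=> e12; rewrite !zmod_evalE; apply/eqP; rewrite subr_eq addrAC eq_sym subr_eq.
by rewrite -!big_cat /= (perm_big _ e12).
Qed.

Ltac zmod_index x env :=
  match env with
  | x :: _ => constr:(0%N)
  | _ :: ?env' => let n := zmod_index x env' in constr:(S n)
  end.

Ltac zmod_atoms t env :=
  match t with
  | GRing.zero => env
  | GRing.add ?a ?b => let env := zmod_atoms a env in zmod_atoms b env
  | GRing.opp ?a => zmod_atoms a env
  | _ => match goal with
         | _ => let n := zmod_index t env in env
         | _ => constr:(t :: env)
         end
  end.

Ltac zmod_reify t env :=
  match t with
  | GRing.zero => constr:(ZZero)
  | GRing.add ?a ?b =>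
      let a := zmod_reify a env in let b := zmod_reify b env in constr:(ZAdd a b)
  | GRing.opp ?a => let a := zmod_reify a env in constr:(ZOpp a)
  | _ => let n := zmod_index t env in constr:(ZAtom n)
  end.

Ltac zmod :=
  match goal with
  | |- @eq ?T ?l ?r =>
      let env := zmod_atoms l (@nil T) in
      let env := zmod_atoms r env in
      let e1 := zmod_reify l env in
      let e2 := zmod_reify r env in
      refine (@zmod_eval_eq _ env e1 e2 _); vm_compute; reflexivity
  end.

(** Lets a known equation [c = d] act as a certificate: what remains is a purely additive goal for
    [zmod]. *)
Lemma eq_by_diff (V : zmodType) (a b c d : V) : c = d -> a - b = c - d -> a = b.
Proof. by move=> -> /eqP; rewrite subrr subr_eq0 => /eqP. Qed.

(** * Associator and triple product identities in alternative rings *)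

Section AlternativeRing.
Variables (V : zmodType) (m : V -> V -> V).
Hypothesis mDl : forall x y z, m (x + y) z = m x z + m y z.
Hypothesis mDr : forall x y z, m x (y + z) = m x y + m x z.

Local Notation "x · y" := (m x y) (at level 40, left associativity).
Let as3 x y z := (x · y) · z - x · (y · z).
Hypothesis as_swap12 : forall x y z, as3 y x z = - as3 x y z.
Hypothesis as_swap23 : forall x y z, as3 x z y = - as3 x y z.

Lemma mulN_l x y : (- x) · y = - (x · y).
Proof.
have m0 : 0 · y = 0 by apply: (addrI (0 · y)); rewrite -mDl !addr0.
by apply: (addrI (x · y)); rewrite -mDl !subrr.
Qed.

Lemma mulN_r x y : x · (- y) = - (x · y).
Proof.
have m0 : x · 0 = 0 by apply: (addrI (x · 0)); rewrite -mDr !addr0.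
by apply: (addrI (x · y)); rewrite -mDr !subrr.
Qed.

Let biadd := (mDl, mDr, mulN_l, mulN_r).

Lemma as_cycle x y z : as3 y z x = as3 x y z.
Proof. by rewrite as_swap23 as_swap12 opprK. Qed.

(** Kleinfeld's function. The swap and the 4-cycle treated below generate all permutations of its
    arguments, so it is skew-symmetric. *)
Let kleinfeld w x y z := as3 (w · x) y z - x · as3 w y z - as3 x y z · w.

Lemma kleinfeld_swap34 w x y z : kleinfeld w x z y = - kleinfeld w x y z.
Proof.
rewrite /kleinfeld (as_swap23 (w · x)) (as_swap23 w) (as_swap23 x) !biadd.
zmod.
Qed.

(** The Teichmüller identity of nonassociative rings, with two associators rotated to bring the
    inner product to the front. *)
Lemma teichmuller w x y z :
  as3 (w · x) y z - as3 (x · y) z w + as3 (y · z) w x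
  = w · as3 x y z + as3 w x y · z.
Proof.
rewrite (as_cycle w (x · y) z) -(as_cycle (y · z) w x) /as3 !biadd.
zmod.
Qed.

(** Adding two cyclically shifted Teichmüller identities cancels the associators that contain
    [x · y] and [y · z]. *)
Lemma kleinfeld_cycle w x y z : kleinfeld z w x y = - kleinfeld w x y z.
Proof.
apply: (eq_by_diff (congr2 +%R (teichmuller w x y z) (teichmuller x y z w))).
rewrite /kleinfeld -(as_cycle w y z) -(as_cycle z x y).
zmod.
Qed.

(* The linearization of the Moufang identity (u, uv, a) = (u, v, a) u. *)
Lemma moufang u v a w :
  as3 (u · v) a w + as3 (w · v) a u = as3 u v a · w + as3 w v a · u.
Proof.
(* Cycling both sides turns this exchange into one of the last two arguments. *)
have swap14 : kleinfeld u v a w = - kleinfeld w v a u.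
  rewrite (kleinfeld_cycle v a w u) (kleinfeld_cycle v a u w).
  by rewrite kleinfeld_swap34.
apply: (eq_by_diff swap14).
rewrite /kleinfeld -(as_cycle u v a) -(as_cycle w v a) (as_cycle u w a) (as_swap23 u a w).
rewrite mulN_r.
zmod.
Qed.

Definition circ x y := x · y + y · x.
Definition alt_triple x y z := (x · y) · z + (z · y) · x.

(** This is [as3 b c a = as3 a b c] rearranged. *)
Lemma circ_mul a b c : circ a (b · c) = (a · b) · c + b · (c · a).
Proof.
apply: (eq_by_diff (as_cycle a b c)).
rewrite /circ /as3.
zmod.
Qed.

Lemma circ_triple a u v w :
  circ a (alt_triple u v w)
  = alt_triple (circ a u) v w - alt_triple u (circ a v) w
    + alt_triple u v (circ a w).
Proof.
have circDr x y z : circ x (y + z) = circ x y + circ x z.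
  rewrite /circ mDl mDr; zmod.
rewrite /alt_triple circDr !circ_mul.
(* Linearized left alternativity moves [a] inside the product [x · y]. *)
have half x y z : (a · (x · y)) · z
    = ((circ a x) · y) · z - (x · (a · y)) · z.
  have -> : a · (x · y) = circ a x · y - x · (a · y).
    apply: (eq_by_diff (esym (as_swap12 a x y))).
    rewrite /as3 /circ !biadd; zmod.
  by rewrite !biadd.
rewrite !half.
(* After cancellation, the discrepancy between the two sides is that of [moufang]. *)
apply: (eq_by_diff (moufang u v a w)).
rewrite /as3 /circ !biadd.
zmod.
Qed.

Lemma triple_sum x y z : alt_triple x y z + alt_triple y x z = circ (circ x y) z.
Proof.
apply: (eq_by_diff (as_swap23 z x y)).
rewrite /alt_triple /circ /as3 !biadd.
zmod.
Qed.

Lemma triple_diff x y z :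
  alt_triple x y z - alt_triple y x z = circ x (circ y z) - circ y (circ x z).
Proof.
apply: (eq_by_diff (congr2 +%R (as_swap23 x y z) (esym (as_swap23 y x z)))).
rewrite /alt_triple /circ /as3 !biadd.
zmod.
Qed.

(** The right side is four times the argument of [alpha] in [twisted_triple]. *)
Lemma triple_double x y z :
  alt_triple x y z + alt_triple x y z
  = circ x (circ y z) + circ (circ x y) z - circ y (circ x z).
Proof.
apply: (eq_by_diff (congr2 +%R (triple_sum x y z) (triple_diff x y z))).
zmod.
Qed.

Lemma triple_double_swap x y z :
  alt_triple y x z + alt_triple y x z
  = circ (circ x y) z - circ x (circ y z) + circ y (circ x z).
Proof.
apply: (eq_by_diff (congr2 +%R (triple_sum x y z) (esym (triple_diff x y z)))).
zmod.
Qed.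

Lemma alt_tripleC x y z : alt_triple x y z = alt_triple z y x.
Proof. exact: addrC. Qed.

(** Doubling avoids division by 2 in [V]. The minus sign in [circ_triple] affects [circ (circ x y)]
    but not the commutator of [circ x] and [circ y], which is why [y x v] appears in the middle
    slot. *)
Lemma triple_identity_double x y u v w :
  let lhs := alt_triple x y (alt_triple u v w)
             - alt_triple u v (alt_triple x y w) in
  let rhs := alt_triple (alt_triple x y u) v w
             - alt_triple u (alt_triple y x v) w in
  lhs + lhs = rhs + rhs.
Proof.
move=> lhs rhs; rewrite {}/lhs {}/rhs.
have circDr a b c : circ a (b + c) = circ a b + circ a c.
  rewrite /circ !biadd; zmod.
have circNr a b : circ a (- b) = - circ a b.
  rewrite /circ !biadd; zmod.
have QDl a b c d : alt_triple (a + b) c d = alt_triple a c d + alt_triple b c d.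
  rewrite /alt_triple !biadd; zmod.
have QDm a b c d : alt_triple a (b + c) d = alt_triple a b d + alt_triple a c d.
  rewrite /alt_triple !biadd; zmod.
have QDr a b c d : alt_triple a b (c + d) = alt_triple a b c + alt_triple a b d.
  rewrite /alt_triple !biadd; zmod.
have QNl a b c : alt_triple (- a) b c = - alt_triple a b c.
  rewrite /alt_triple !biadd; zmod.
have QNm a b c : alt_triple a (- b) c = - alt_triple a b c.
  rewrite /alt_triple !biadd; zmod.
have QNr a b c : alt_triple a b (- c) = - alt_triple a b c.
  rewrite /alt_triple !biadd; zmod.
rewrite [LHS]addrACA [RHS]addrACA -!opprD.
rewrite -(QDl (alt_triple x y u)) -(QDm u (alt_triple y x v)).
rewrite -(QDr u v (alt_triple x y w)) (triple_double_swap x y) !(triple_double x y).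
rewrite !(circ_triple, circDr, circNr, QDl, QDm, QDr, QNl, QNm, QNr).
zmod.
Qed.

End AlternativeRing.

(** * Transfer to the twisted product over the field *)

Theorem corollary3p16 (k : fieldType) (char0 : [pchar k] =i pred0)
    (A : lmodType k) (mu : {bilinear A -> A -> A})
    (altA : alternative_algebra mu)
    (alpha : {linear A -> A}) (alphaM : algebra_morphism mu alpha) :
  multiplicative_hjts (twisted_triple mu alpha) alpha.
Proof.
have two_neq0 : (2%:R : k) != 0 by rewrite ((pcharf0P k).1 char0).
have muDl x y z : mu (x + y) z = mu x z + mu y z by exact: linearDl.
have muDr x y z : mu x (y + z) = mu x y + mu x z by exact: linearDr.
have muZl c x y : mu (c *: x) y = c *: mu x y by exact: linearZl_LR.
have muZr c x y : mu x (c *: y) = c *: mu x y by exact: linearZr.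
have [as12 as23 _] := altA.
pose h : k := 2%:R^-1; pose Q := alt_triple mu.
have half (x : A) : h *: (x + x) = x.
  by rewrite -mulr2n -scaler_nat scalerA mulVf // scale1r.
have TE x y z : twisted_triple mu alpha x y z = h *: alpha (Q x y z).
  rewrite -linearZ; congr (alpha _).
  have circZ c (a b : A) : circ mu a (c *: b) = c *: circ mu a b.
    by rewrite /circ muZl muZr scalerDr.
  have circZl c (a b : A) : circ mu (c *: a) b = c *: circ mu a b.
    by rewrite /circ muZl muZr scalerDr.
  have starE a b : jordan_mul mu a b = h *: circ mu a b by [].
  rewrite !starE !circZ circZl -!scalerDr -!scalerBr.
  (* Of the two factors [h], one absorbs the doubling and the other survives. *)
  by rewrite -(triple_double muDl muDr as23) half.
have alphaQ x y z : alpha (Q x y z) = Q (alpha x) (alpha y) (alpha z).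
  by rewrite linearD !alphaM.
have QZ c x y z : Q x y (c *: z) = c *: Q x y z.
  by rewrite /Q /alt_triple muZl !muZr muZl scalerDr.
have QC x y z : Q x y z = Q z y x by exact: alt_tripleC.
have QZl c x y z : Q (c *: x) y z = c *: Q x y z by rewrite QC QZ QC.
have QZm c x y z : Q x (c *: y) z = c *: Q x y z.
  by rewrite /Q /alt_triple !(muZl, muZr) scalerDr.
have QDl x x' y z : Q (x + x') y z = Q x y z + Q x' y z.
  by rewrite /Q /alt_triple !(muDl, muDr) addrACA.
have QDm x y y' z : Q x (y + y') z = Q x y z + Q x y' z.
  by rewrite /Q /alt_triple !(muDl, muDr) addrACA.
have JI x y u v w : Q x y (Q u v w) - Q u v (Q x y w)
    = Q (Q x y u) v w - Q u (Q y x v) w.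
  rewrite -[LHS]half -[RHS]half; congr (_ *: _).
  exact: (triple_identity_double muDl muDr as12 as23).
have Tlin x y : linear (fun z => twisted_triple mu alpha x y z).
  move=> c z z'; rewrite !TE (QC x) QDl QZl !(QC _ y x) linearP scalerDr.
  by rewrite !scalerA mulrC.
split; last by move=> x y z; rewrite !TE linearZ /= alphaQ.
split; try exact: linearP.
- split=> // [y z|x z] c a b.
    by rewrite !TE QDl QZl linearP scalerDr !scalerA mulrC.
  by rewrite !TE QDm QZm linearP scalerDr !scalerA mulrC.
- by move=> x y z; rewrite !TE QC.
(* Every term acquires the same two factors [h] and two applications of [alpha], leaving [JI]. *)
- move=> x y u v w; rewrite !TE !(QZ, QZl, QZm) -!alphaQ !linearZ /=.
  by rewrite -!scalerDr -!linearB JI.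
Qed.
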